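(* Let $p$ be an odd prime and let $G$ be a finite $p$-group with $d(G)=3$, $\Phi(G)\le Z(G)$, $G'\cong C_p^3$ and $G/G'$ of type $(p^{m_1},p^{m_2},p^{m_3})$ with $m_1=m_2=m_3$, and suppose $G$ is determined by one of the characteristic matrices (J1)–(J5), (K1)–(K6), (L1)–(L3) listed in the context. (1) If $I_{\min}=m_3$, then the characteristic matrix is one of: (J1)–(J5), (K1)–(K6). (2) If $I_{\min}=m_3+1$, then the characteristic matrix is one of: (L2)–(L3). (3) If $I_{\min}=m_3+2$, then the characteristic matrix is (L1). (4) If $I_{\max}=m_1+2$, then the characteristic matrix is one of: (K1) with $-\nu\in(F_p^* )^2$, (K3)–(K5), (K6) with $-r\in(F_p^* )^2$, (L1)–(L3). (5) If $I_{\max}=m_1+1$, then the characteristic matrix is one of: (J1)–(J5), (K1) with $-\nu\notin(F_p^* )^2$, (K2), (K6) with $-r\notin(F_p^* )^2$.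
   Context: $d(G)$ is the minimal number of generators, $\Phi(G)$ the Frattini subgroup, $G'$ the derived subgroup, $C_p^3$ elementary abelian of order $p^3$, $F_p$ the field with $p$ elements, $F_p^*$ its multiplicative group and $(F_p^* )^2=\{a^2:a\in F_p^*\}$. An $\mathcal{A}_1$-group is a minimal non-abelian group (non-abelian with all proper subgroups abelian). $p^{I_{\min}}$ and $p^{I_{\max}}$ denote respectively the minimal and the maximal index in $G$ of $\mathcal{A}_1$-subgroups of $G$. Characteristic matrix: let $G/G'$ have type $(p^{m_1},p^{m_2},p^{m_3})$, $m_1\ge m_2\ge m_3\ge1$ (i.e. $G/G'\cong C_{p^{m_1}}\times C_{p^{m_2}}\times C_{p^{m_3}}$). Choose $a_1,a_2,a_3\in G$ with $G/G'=\langle a_1G'\rangle\times\langle a_2G'\rangle\times\langle a_3G'\rangle$, $o(a_iG')=p^{m_i}$; put $x=[a_2,a_3]$, $y=[a_3,a_1]$, $z=[a_1,a_2]$, so $G'=\langle x,y,z\rangle$, and write $a_i^{p^{m_i}}=x^{w_{i1}}y^{w_{i2}}z^{w_{i3}}$. The matrix $w(G)=(w_{ij})$ over $F_p$ is called a characteristic matrix of $G$; together with $p,m_1,m_2,m_3$ it determines $G$ up to isomorphism. Let $e_{ij}$ be the $3\times3$ matrix over $F_p$ with $1$ at $(i,j)$ and $0$ elsewhere; $\eta$ a fixed square non-residue modulo $p$; $\nu\in\{1,\eta\}$; $r\in\{1,\dots,p-2\}$. The list is: (J1) $e_{11}+e_{22}+e_{33}$; (J2) $e_{11}+e_{23}-e_{32}$;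 (J3) $e_{11}+\nu e_{22}+e_{23}-e_{32}$; (J4) $e_{11}+e_{22}+e_{23}-e_{32}+re_{33}$; (J5) $e_{13}+e_{22}+e_{23}+e_{31}-e_{32}$; (K1) $e_{11}+\nu e_{22}$; (K2) $e_{11}+e_{23}$; (K3) $e_{13}+e_{32}$; (K4) $e_{23}-e_{32}$; (K5) $e_{22}+e_{23}-e_{32}$; (K6) $e_{22}+e_{23}-e_{32}+re_{33}$; (L1) $0$; (L2) $e_{11}$; (L3) $e_{23}$. *)

(* Defs.v *)
From mathcomp Require Import all_boot all_order all_algebra.
From mathcomp Require Import all_fingroup all_solvable.

Set Implicit Arguments.
Unset Strict Implicit.
Unset Printing Implicit Defensive.

Import GRing.Theory.

Local Open Scope group_scope.

(* Indices of 3 x 3 matrices are written 1, 2, 3 as in the mathematical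
   notation, and shifted to the elements 0, 1, 2 of 'I_3. *)
Definition idx3 (i : nat) : 'I_3 := inord i.-1.

Section Matrices.

Variable p : nat.

Local Open Scope ring_scope.

Definition e (i j : nat) : 'M['F_p]_3 := delta_mx (idx3 i) (idx3 j).

(* (F_p^* )^2 *)
Definition Fp_squares : {set 'F_p} := [set a ^+ 2 | a : 'F_p & a != 0].

Definition J1 : 'M['F_p]_3 := e 1 1 + e 2 2 + e 3 3.
Definition J2 : 'M['F_p]_3 := e 1 1 + e 2 3 - e 3 2.
Definition J3 (nu : 'F_p) : 'M['F_p]_3 := e 1 1 + nu *: e 2 2 + e 2 3 - e 3 2.
Definition J4 (r : 'F_p) : 'M['F_p]_3 :=
  e 1 1 + e 2 2 + e 2 3 - e 3 2 + r *: e 3 3.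
Definition J5 : 'M['F_p]_3 := e 1 3 + e 2 2 + e 2 3 + e 3 1 - e 3 2.

Definition K1 (nu : 'F_p) : 'M['F_p]_3 := e 1 1 + nu *: e 2 2.
Definition K2 : 'M['F_p]_3 := e 1 1 + e 2 3.
Definition K3 : 'M['F_p]_3 := e 1 3 + e 3 2.
Definition K4 : 'M['F_p]_3 := e 2 3 - e 3 2.
Definition K5 : 'M['F_p]_3 := e 2 2 + e 2 3 - e 3 2.
Definition K6 (r : 'F_p) : 'M['F_p]_3 := e 2 2 + e 2 3 - e 3 2 + r *: e 3 3.

Definition L1 : 'M['F_p]_3 := 0.
Definition L2 : 'M['F_p]_3 := e 1 1.
Definition L3 : 'M['F_p]_3 := e 2 3.

Definition nu_range (eta : 'F_p) : seq 'F_p := [:: 1; eta].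

(* The images in 'F_p of the integers 1, ..., p - 2. *)
Definition r_range : seq 'F_p := [seq r%:R | r <- iota 1 (p - 2)].

Definition J_list (eta : 'F_p) : seq 'M['F_p]_3 :=
  [:: J1; J2] ++ [seq J3 nu | nu <- nu_range eta]
    ++ [seq J4 r | r <- r_range] ++ [:: J5].

Definition K_list (eta : 'F_p) : seq 'M['F_p]_3 :=
  [seq K1 nu | nu <- nu_range eta] ++ [:: K2; K3; K4; K5]
    ++ [seq K6 r | r <- r_range].

Definition L_list : seq 'M['F_p]_3 := [:: L1; L2; L3].

End Matrices.

Section Groups.

Variable gT : finGroupType.
Implicit Type G : {group gT}.

(* In a_i^(p^m_i) = x^w_i1 y^w_i2 z^w_i3 an entry of w, an element of 'F_p, is
   coerced to its representative in {0, ..., p - 1}; this is harmless as x, y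
   and z have order dividing p in the groups under consideration. *)
Definition characteristic_matrix (p : nat) G (m1 m2 m3 : nat)
    (w : 'M['F_p]_3) : Prop :=
  exists a1 a2 a3 : gT,
    let x := [~ a2, a3] in
    let y := [~ a3, a1] in
    let z := [~ a1, a2] in
    let word i := x ^+ w (idx3 i) (idx3 1) * y ^+ w (idx3 i) (idx3 2)
                    * z ^+ w (idx3 i) (idx3 3) in
    [/\ [/\ a1 \in G, a2 \in G & a3 \in G],
        <[coset G^`(1) a1]> \x <[coset G^`(1) a2]> \x <[coset G^`(1) a3]>
          = G / G^`(1),
        [/\ #[coset G^`(1) a1] = (p ^ m1)%N, #[coset G^`(1) a2] = (p ^ m2)%N
          & #[coset G^`(1) a3] = (p ^ m3)%N]
      & [/\ a1 ^+ (p ^ m1)%N = word 1%N, a2 ^+ (p ^ m2)%N = word 2%N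
          & a3 ^+ (p ^ m3)%N = word 3%N]].

Definition A1_subgroup G (H : {group gT}) : Prop :=
  H \subset G /\ [min H | ~~ abelian H].

(* I_min = k, i.e. p ^ k is the least index of an A_1-subgroup. *)
Definition is_Imin (p : nat) G (k : nat) : Prop :=
  (exists2 H : {group gT}, A1_subgroup G H & #|G : H| = (p ^ k)%N)
  /\ (forall H : {group gT}, A1_subgroup G H -> (p ^ k <= #|G : H|)%N).

(* I_max = k, i.e. p ^ k is the greatest index of an A_1-subgroup. *)
Definition is_Imax (p : nat) G (k : nat) : Prop :=
  (exists2 H : {group gT}, A1_subgroup G H & #|G : H| = (p ^ k)%N)
  /\ (forall H : {group gT}, A1_subgroup G H -> (#|G : H| <= p ^ k)%N).

End Groups.

(* Main.v *)
(* V = G / Phi(G) is F_p^3, and since Phi(G) is central and p is odd, the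
   commutator V x V -> G' = F_p^3 is the cross product, while the p^m-power map
   V -> G' is the linear map of matrix w. A minimal non-abelian subgroup is
   generated by two elements of independent classes u and v, and has index
   p^(m + 3 - s), s being the rank of {u x v, u w, v w}; so I_min = m + 3 - max s
   and I_max = m + 3 - min s. Here s = 3 for some u, v iff the quadratic form of
   the cofactor matrix of w is nonzero, and s = 1 iff w maps the plane <u, v> into
   its normal line. When w has rank 2 the plane must contain the kernel of w, and
   this amounts to nu a^2 + b^2 = 0 for (K1) and r a^2 + b^2 = 0 for (K6). *)

Require Import Defs.
From mathcomp Require Import all_boot all_order all_algebra.
From mathcomp Require Import all_fingroup all_solvable.
From mathcomp Require Import mxabelem ring.

Set Implicit Arguments.
Unset Strict Implicit.
Unset Printing Implicit Defensive.

Import GRing.Theory.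

Local Open Scope group_scope.

(** * Linear algebra in dimension three *)

Section LinearAlgebra.

Local Open Scope ring_scope.

Variable F : fieldType.

Definition vec3 (a b c : F) : 'rV[F]_3 := \row_j [:: a; b; c]`_j.

Definition mat3 (a b c a' b' c' a'' b'' c'' : F) : 'M[F]_3 :=
  \matrix_i [:: vec3 a b c; vec3 a' b' c'; vec3 a'' b'' c'']`_i.

Lemma vec3_inj a b c a' b' c' :
  vec3 a b c = vec3 a' b' c' -> [/\ a = a', b = b' & c = c'].
Proof.
by move/rowP=> E; split; [have := E 0 | have := E 1 | have := E (inord 2)];
  rewrite !mxE ?inordK.
Qed.

Lemma vec3P (u : 'rV[F]_3) : {abc : F * F * F | u = vec3 abc.1.1 abc.1.2 abc.2}.
Proof.
exists (u 0 0, u 0 1, u 0 (inord 2)); apply/rowP => j; rewrite mxE.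
case: j => [[|[|[|//]]] lt_j] /=; congr (u _ _); apply: val_inj => //=.
by rewrite inordK.
Qed.

Lemma vec3D a b c a' b' c' :
  vec3 a b c + vec3 a' b' c' = vec3 (a + a') (b + b') (c + c').
Proof. by apply/rowP => -[[|[|[|//]]] ?]; rewrite !mxE. Qed.

Lemma vec3Z k a b c : k *: vec3 a b c = vec3 (k * a) (k * b) (k * c).
Proof. by apply/rowP => -[[|[|[|//]]] ?]; rewrite !mxE. Qed.

Lemma vec3_0 : vec3 0 0 0 = 0.
Proof. by apply/rowP => -[[|[|[|//]]] ?]; rewrite !mxE. Qed.

Lemma mul_vec3_mat3 x y z a b c a' b' c' a'' b'' c'' :
  vec3 x y z *m mat3 a b c a' b' c' a'' b'' c'' =
  vec3 (x * a + y * a' + z * a'') (x * b + y * b' + z * b'')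
       (x * c + y * c' + z * c'').
Proof.
apply/rowP => j; rewrite !mxE !big_ord_recl big_ord0 !mxE /=.
by case: j => [[|[|[|//]]] ?] /=; rewrite addr0 addrA.
Qed.

Definition cross (u v : 'rV[F]_3) : 'rV[F]_3 :=
  vec3 (u 0 1 * v 0 (inord 2) - u 0 (inord 2) * v 0 1)
       (u 0 (inord 2) * v 0 0 - u 0 0 * v 0 (inord 2))
       (u 0 0 * v 0 1 - u 0 1 * v 0 0).

Lemma cross_vec3 a b c a' b' c' :
  cross (vec3 a b c) (vec3 a' b' c') =
  vec3 (b * c' - c * b') (c * a' - a * c') (a * b' - b * a').
Proof. by rewrite /cross !mxE !inordK. Qed.

Lemma crossDl u u' v : cross (u + u') v = cross u v + cross u' v.
Proof.
by rewrite vec3D; congr vec3; rewrite !mxE; ring.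
Qed.

Lemma crossDr u v v' : cross u (v + v') = cross u v + cross u v'.
Proof.
by rewrite vec3D; congr vec3; rewrite !mxE; ring.
Qed.

(* Rows: the coordinates in G' of [g, h], g ^ p ^ m and h ^ p ^ m, when g and h have
   coordinates u and v. *)
Definition span_mx (w : 'M[F]_3) (u v : 'rV[F]_3) : 'M[F]_(1 + (1 + 1), 3) :=
  col_mx (cross u v) (col_mx u v *m w).

Lemma span_mxE w u v :
  span_mx w u v = col_mx (cross u v) (col_mx (u *m w) (v *m w)).
Proof. by rewrite /span_mx mul_col_mx. Qed.

(** Crossing the combination with [v] on the right kills the [v] term and leaves [k *: cross u v];
    crossing it with [u] on the left leaves [l *: cross u v]. *)
Lemma cross_free u v k l : cross u v != 0 -> k *: u + l *: v = 0 ->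
  k = 0 /\ l = 0.
Proof.
move=> nz kl0; have kE : k *: cross u v = cross (k *: u + l *: v) v.
  by rewrite vec3Z; congr vec3; rewrite !mxE; ring.
have lE : l *: cross u v = cross u (k *: u + l *: v).
  by rewrite vec3Z; congr vec3; rewrite !mxE; ring.
move: kE lE; rewrite kl0 /cross !mxE !mul0r !mulr0 subrr vec3_0 -/(cross u v).
by move=> /eqP + /eqP; rewrite !scaler_eq0 (negPf nz) !orbF => /eqP-> /eqP->.
Qed.

Lemma row_free_cross u v : cross u v != 0 -> row_free (col_mx u v).
Proof.
move=> nz; apply: inj_row_free => c; rewrite -[c]hsubmxK mul_row_col.
rewrite [lsubmx c]mx11_scalar [rsubmx c]mx11_scalar !mul_scalar_mx.
by move=> /(cross_free nz)[-> ->]; rewrite raddf0 row_mx0.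
Qed.

Lemma rank_span_mx_le w u v : (\rank (span_mx w u v) <= 1 + \rank w)%N.
Proof.
rewrite /span_mx -addsmxE (leq_trans (mxrank_adds_leqif _ _)) //.
by rewrite leq_add ?rank_leq_row // mxrankS ?submxMl.
Qed.

Lemma rank_span_mx_gt0 w u v : cross u v != 0 -> (0 < \rank (span_mx w u v))%N.
Proof.
rewrite lt0n mxrank_eq0; apply: contra => /eqP M0.
by rewrite -(col_mxKu (cross u v) (col_mx u v *m w)) -/(span_mx _ _ _) M0 linear0.
Qed.

(** The first row is nonzero, so rank one forces the other two rows onto its line: [w] maps the
    plane of [u] and [v] into the normal line. *)
Lemma rank_span_mx1P w u v : cross u v != 0 ->
  reflect (exists k l, u *m w = k *: cross u v /\ v *m w = l *: cross u v)
          (\rank (span_mx w u v) == 1%N).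
Proof.
move=> nz; have rk1 : \rank (cross u v) = 1%N by rewrite rank_rV nz.
have sub : (cross u v <= span_mx w u v)%MS by rewrite /span_mx -addsmxE addsmxSl.
have := mxrank_leqif_sup sub; rewrite rk1 eq_sym => -[_ ->].
rewrite span_mxE !col_mx_sub submx_refl /=.
apply: (iffP andP) => [[/sub_rVP[k ->] /sub_rVP[l ->]] | [k [l [-> ->]]]].
  by exists k, l.
by split; apply/sub_rVP; [exists k | exists l].
Qed.

(** An invertible [w] keeps the independent rows [u] and [v] independent, so the last two rows alone
    have rank two. *)
Lemma rank_span_mx2 w u v : w \in unitmx -> cross u v != 0 ->
  (1 < \rank (span_mx w u v))%N.
Proof.
move=> wU nz; rewrite /span_mx -addsmxE.
apply: leq_trans (mxrankS (addsmxSr _ _)).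
by rewrite mxrankMfree ?row_free_unit // (eqP (row_free_cross nz)).
Qed.

Lemma det_mat3 a b c a' b' c' a'' b'' c'' :
  \det (mat3 a b c a' b' c' a'' b'' c'') =
  a * (b' * c'' - c' * b'') + b * (c' * a'' - a' * c'') + c * (a' * b'' - b' * a'').
Proof.
rewrite (expand_det_row _ ord0) !big_ord_recl big_ord0 /cofactor.
rewrite !(expand_det_row _ ord0) !big_ord_recl !big_ord0 /cofactor !det_mx11.
by rewrite !mxE /=; ring.
Qed.

Lemma col_mx_vec3 a b c a' b' c' a'' b'' c'' :
  col_mx (vec3 a b c) (col_mx (vec3 a' b' c') (vec3 a'' b'' c'')) =
  mat3 a b c a' b' c' a'' b'' c'' :> 'M_(1 + (1 + 1), 3).
Proof.
apply/matrixP => i j; rewrite !mxE; case: splitP => [k -> | k ->].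
  by rewrite (ord1 k) !mxE.
rewrite mxE; case: splitP => l ->; by rewrite (ord1 l) !mxE.
Qed.

End LinearAlgebra.

(** * Ranks attained by independent pairs of vectors *)

Section Spectrum.

Local Open Scope ring_scope.

Variable F : fieldType.

(** The possible values of s in the index formula p^(m + 3 - s); independence of the pair is encoded
    as a nonzero cross product. *)
Definition rank_spectrum (w : 'M[F]_3) (s : nat) : Prop :=
  exists u v, cross u v != 0 /\ \rank (span_mx w u v) = s.

Lemma vec3_eq0 (a b c : F) : (vec3 a b c == 0) = [&& a == 0, b == 0 & c == 0].
Proof.
apply/eqP/and3P => [|[/eqP-> /eqP-> /eqP->]]; last exact: vec3_0.
by rewrite -vec3_0 => /vec3_inj[-> -> ->].
Qed.

(** Independence of [u] and [v] comes for free: with a zero first row the rank would be at most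
    two. *)
Lemma det_span_mx (w : 'M[F]_3) (u v : 'rV_3) :
  \det (span_mx w u v : 'M_3) != 0 -> rank_spectrum w 3.
Proof.
move=> nz; exists u, v; have rk3 : \rank (span_mx w u v) = 3%N.
  by apply: mxrank_unit; rewrite unitmxE unitfE.
split=> //; apply: contra_eqN rk3 => /eqP; rewrite /span_mx => ->.
rewrite -addsmxE ltn_eqF // ltnS (leq_trans (mxrank_adds_leqif _ _)) //.
by rewrite mxrank0 (leq_trans (mxrankM_maxl _ _)) ?rank_leq_row.
Qed.

Lemma spectrum1_intro (w : 'M[F]_3) (u v : 'rV_3) (k l : F) : cross u v != 0 ->
  u *m w = k *: cross u v -> v *m w = l *: cross u v -> rank_spectrum w 1.
Proof.
move=> nz uw vw; exists u, v; split=> //.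
by apply/eqP/(rank_span_mx1P w nz); exists k, l.
Qed.

Lemma spectrum_le (w : 'M[F]_3) s : rank_spectrum w s ->
  (0 < s <= minn 3 (1 + \rank w))%N.
Proof.
case=> u [v [nz <-]]; rewrite rank_span_mx_gt0 // leq_min rank_leq_row.
exact: rank_span_mx_le.
Qed.

Definition spanE := (cross_vec3, mul_vec3_mat3, span_mxE, col_mx_vec3, det_mat3).

Lemma spectrum3_K1 (nu : F) : nu != 0 ->
  rank_spectrum (mat3 1 0 0 0 nu 0 0 0 0) 3.
Proof.
move=> nu0; apply: (@det_span_mx _ (vec3 1 0 0) (vec3 0 1 0)).
by rewrite !spanE; apply: contra_neq nu0 => <-; ring.
Qed.

Lemma spectrum1_unit (w : 'M[F]_3) : w \in unitmx -> ~ rank_spectrum w 1.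
Proof. by move=> wU [u [v [/(rank_span_mx2 wU) + rk1]]]; rewrite rk1. Qed.

Lemma dot_vec3 a b c a' b' c' :
  (vec3 a b c *m (vec3 a' b' c' : 'rV[F]_3)^T) 0 0 = a * a' + b * b' + c * c'.
Proof. by rewrite !mxE !big_ord_recl big_ord0 !mxE /=; ring. Qed.

(* The plane orthogonal to n is spanned by u and v, hence contains u and the
   vector z of the kernel of w. *)
Lemma spectrum1P (w : 'M[F]_3) : rank_spectrum w 1 -> rank_spectrum w 3 ->
  exists n u z : 'rV[F]_3, exists k,
    [/\ n != 0 /\ k != 0, u *m w = k *: n, (u *m n^T) 0 0 = 0
      & [/\ z != 0, z *m w = 0 & (z *m n^T) 0 0 = 0]].
Proof.
case=> u [v [nz rk1]] /spectrum_le; rewrite leq_min => /and3P[_ _ rkw].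
have [k [l [uw vw]]] := rank_span_mx1P w nz (introT eqP rk1).
have [dotu dotv] : (u *m (cross u v)^T) 0 0 = 0 /\ (v *m (cross u v)^T) 0 0 = 0.
  have [[[a b] c] /= ->] := vec3P u; have [[[a' b'] c'] /= ->] := vec3P v.
  by split; rewrite cross_vec3 dot_vec3; ring.
set z := l *: u + - k *: v.
have zw : z *m w = 0.
  by rewrite mulmxDl -!scalemxAl uw vw !scalerA mulNr mulrC scaleNr subrr.
have dotz : (z *m (cross u v)^T) 0 0 = 0.
  rewrite mulmxDl -!scalemxAl mxE [X in X + _]mxE [X in _ + X]mxE.
  by rewrite dotu dotv !mulr0 addr0.
have z0 : (k != 0) || (l != 0) -> z != 0.
  rewrite -negb_and; apply: contra => /eqP /(cross_free nz)[-> /eqP].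
  by rewrite oppr_eq0 eqxx andbT.
exists (cross u v).
have [k0 | k0] := eqVneq k 0; last by exists u, z, k; rewrite z0 ?k0.
have [l0 | l0] := eqVneq l 0; last by exists v, z, l; rewrite z0 ?l0 ?orbT.
(* Here [k] and [l] both vanish, so the whole plane lies in the kernel and [w] has rank at most one;
   but a pair of rank three requires rank at least two. *)
have := mxrank_mul_min (col_mx u v) w; rewrite ltnS in rkw.
rewrite mul_col_mx uw vw k0 l0 !scale0r col_mx0 mxrank0.
rewrite (eqP (row_free_cross nz)) leqn0 subn_eq0 => le3.
by have := leq_trans (leq_add (leqnn (1 + 1)) rkw) le3.
Qed.

(** The normal [n] lies in the image of the matrix, so its third entry is 0, and orthogonality of
    [u] to [n] becomes nu n1^2 + n2^2 = 0. Since n is nonzero, so is n1, and -nu is the square of n2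
    / n1. *)
Lemma spectrum1_K1 (nu : F) : nu != 0 ->
  rank_spectrum (mat3 1 0 0 0 nu 0 0 0 0) 1 ->
  exists2 a, a != 0 & - nu = a ^+ 2.
Proof.
move=> nu0 /spectrum1P/(_ (spectrum3_K1 nu0))[n [u [z [k [[n0 k0]]]]]].
have [[[a b] c] /= ->] := vec3P u; have [[[n1 n2] n3] /= nE] := vec3P n.
rewrite nE dot_vec3 mul_vec3_mat3 vec3Z vec3_eq0 in n0 *.
move=> /vec3_inj[+ + +] + _; rewrite !(mulr0, addr0, add0r, mulr1).
move=> aE bE /esym/eqP; rewrite mulf_eq0 (negPf k0) => /eqP n30.
rewrite n30 mulr0 addr0 => dot.
have /eqP : k * (nu * n1 ^+ 2 + n2 ^+ 2) = 0.
  by rewrite -[RHS](mulr0 nu) -dot aE; ring: bE.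
rewrite mulf_eq0 (negPf k0) /= addr_eq0 => /eqP sq.
have n10 : n1 != 0.
  apply: contraNneq n0 => n10; move: sq; rewrite n10 n30 eqxx andbT /=.
  by rewrite expr0n mulr0 => /esym/eqP; rewrite oppr_eq0 expf_eq0.
exists (n2 / n1).
  rewrite mulf_neq0 ?invr_eq0 //; apply: contra_neq nu0 => n20.
  by apply: (mulIf (expf_neq0 2 n10)); rewrite sq n20 expr0n oppr0 mul0r.
by rewrite expr_div_n -[n2 ^+ 2]opprK -sq mulNr mulfK ?expf_neq0.
Qed.

Lemma spectrum3_K2 : rank_spectrum (mat3 1 0 0 0 0 1 0 0 0) 3.
Proof.
(* The pair e1, e2 fails, as its cross product e3 equals e2 w. Subtracting the kernel vector e3 from
   e2 changes the cross product but not the image. *)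
apply: (@det_span_mx _ (vec3 1 0 0) (vec3 0 1 (-1))).
by rewrite !spanE -oppr_eq0; apply: contra_neq (oner_neq0 F) => <-; ring.
Qed.

(** The image of the matrix forces n2 = 0. The kernel is the line of e3, which must lie in the
    plane, so n3 = 0. Orthogonality of [u] then leaves k n1^2 = 0, and the normal vanishes. *)
Lemma spectrum1_K2 : ~ rank_spectrum (mat3 1 0 0 0 0 1 0 0 0) 1.
Proof.
move=> /spectrum1P/(_ spectrum3_K2)[n [u [z [k [[n0 k0]]]]]].
have [[[a b] c] /= ->] := vec3P u; have [[[a' b'] c'] /= ->] := vec3P z.
have [[[n1 n2] n3] /= nE] := vec3P n; move: n0.
rewrite nE !dot_vec3 !mul_vec3_mat3 vec3Z !vec3_eq0 -vec3_0.
rewrite !(mulr0, addr0, add0r, mulr1) => n0.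
move=> /vec3_inj[aE /esym/eqP + _] dot [z0 /vec3_inj[a'0 _ b'0] dotz].
rewrite mulf_eq0 (negPf k0) => /eqP n20.
move: z0 dotz; rewrite a'0 b'0 !mul0r !add0r eqxx /= => c'0 /eqP.
rewrite mulf_eq0 (negPf c'0) => /eqP n30; move: dot.
rewrite aE n20 n30 !mulr0 !addr0 => /eqP; rewrite !mulf_eq0 (negPf k0) orbb.
by move=> /eqP n10; rewrite n10 n20 n30 eqxx in n0.
Qed.

Lemma spectrum3_K6 (r : F) : r + 1 != 0 ->
  rank_spectrum (mat3 0 0 0 0 1 1 0 (-1) r) 3.
Proof.
move=> r1; apply: (@det_span_mx _ (vec3 0 1 0) (vec3 0 0 1)).
by rewrite !spanE; apply: contra_neq r1 => <-; ring.
Qed.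

Lemma spectrum1_K6 (r : F) : r != 0 -> r + 1 != 0 ->
  rank_spectrum (mat3 0 0 0 0 1 1 0 (-1) r) 1 ->
  exists2 a, a != 0 & - r = a ^+ 2.
Proof.
move=> r0 r1 /spectrum1P/(_ (spectrum3_K6 r1))[n [u [z [k [[n0 k0]]]]]].
have [[[a b] c] /= ->] := vec3P u; have [[[n1 n2] n3] /= nE] := vec3P n.
rewrite nE dot_vec3 mul_vec3_mat3 vec3Z vec3_eq0 in n0 *.
move=> /vec3_inj[+ + +] + _; rewrite !(mulr0, addr0, add0r, mulr1).
move=> /esym/eqP; rewrite mulf_eq0 (negPf k0) => /eqP n10 n2E n3E.
rewrite n10 mulr0 add0r => dot.
have /eqP : k * (r * n2 ^+ 2 + n3 ^+ 2) = 0.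
  (* The two bracketed factors are (r + 1) b and (r + 1) c, obtained by solving b - c = k n2 and b +
     r c = k n3; the sum is thus r + 1 times the product of [u] and [n]. *)
  have -> : k * (r * n2 ^+ 2 + n3 ^+ 2) =
      n2 * (r * (k * n2) + k * n3) + n3 * (k * n3 - k * n2) by ring.
  by rewrite -n2E -n3E -[RHS](mulr0 (r + 1)) -dot; ring.
rewrite mulf_eq0 (negPf k0) /= addr_eq0 => /eqP sq.
have n20 : n2 != 0.
  apply: contraNneq n0 => n20; move: sq; rewrite n10 n20 eqxx /=.
  by rewrite expr0n mulr0 => /esym/eqP; rewrite oppr_eq0 expf_eq0.
exists (n3 / n2).
  rewrite mulf_neq0 ?invr_eq0 //; apply: contra_neq r0 => n30.
  by apply: (mulIf (expf_neq0 2 n20)); rewrite sq n30 expr0n oppr0 mul0r.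
by rewrite expr_div_n -[n3 ^+ 2]opprK -sq mulNr mulfK ?expf_neq0.
Qed.

End Spectrum.

(** * Minimal non-abelian subgroups *)

Section MinimalNonabelian.

Variables (gT : finGroupType) (p : nat).
Implicit Types G H K Z : {group gT}.

Hypothesis p_pr : prime p.

(** A quotient by [Z] of order 1 or p would be cyclic, and a group that is cyclic modulo a central
    subgroup is abelian. *)
Lemma nonabelian_central_index Z G : p.-group G -> Z \subset 'Z(G) ->
  ~~ abelian G -> p ^ 2 <= #|G : Z|.
Proof.
move=> pG sZ; have [k kE] := p_natP (quotient_pgroup Z pG).
rewrite -card_quotient ?(normal_norm (sub_center_normal sZ)) // kE.
rewrite (leq_exp2l _ _ (prime_gt1 p_pr)); apply: contraR; rewrite -ltnNge ltnS => k1.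
apply: (cyclic_factor_abelian sZ); case: k k1 kE => [|[|//]] _ kE.
  by rewrite (card1_trivg kE) cyclic1.
by rewrite prime_cyclic // kE.
Qed.

Lemma Phi_index_le G : p.-group G -> #|G : 'Phi(G)| <= p ^ 'm(G).
Proof.
move=> pG; have eG := Phi_quotient_abelem pG.
rewrite -card_quotient ?gFnorm // (card_pgroup (abelem_pgroup eG)).
rewrite leq_exp2l ?prime_gt1 // -(rank_abelem eG).
rewrite -grank_abelian ?(abelem_abelian eG) //.
exact: quotient_grank (gFnorm _ _).
Qed.

Lemma grank_set2 (g h : gT) : 'm(<<[set g; h]>>) <= 2.
Proof. by rewrite (leq_trans (grank_min _)) // cards2; case: eqP. Qed.

Lemma gen_set2 (g h : gT) : <<[set g; h]>> = <[g]> <*> <[h]>.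
Proof. by rewrite joing_idl joing_idr. Qed.

Lemma card_cent_joing G H : H \subset 'C(G) -> #|G <*> H| <= #|G| * #|H|.
Proof.
by move=> cGH; rewrite cent_joinEr // mul_cardG leq_pmulr ?cardG_gt0.
Qed.

Lemma gen2_nonabelian (g h : gT) : [~ g, h] != 1 -> ~~ abelian <<[set g; h]>>.
Proof.
apply: contra => /centsP cHH; apply/commgP/cHH;
  by rewrite mem_gen // !inE eqxx ?orbT.
Qed.

Variables (G : {group gT}) (pG : p.-group G) (PhiZ : 'Phi(G) \subset 'Z(G)).

Lemma Phi_central H : H \subset G -> 'Phi(H) \subset 'C(G).
Proof.
move=> sHG; apply: subset_trans (PhiS pG sHG) (subset_trans PhiZ _).
exact: subsetIr.
Qed.

(** In H = <g, h> the subgroup ['Phi(H)] is central of index at most p^2. A maximal subgroup of H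
    contains it with index at most p, too small for a non-abelian group by
    [nonabelian_central_index]. *)
Lemma gen2_A1 (g h : gT) : g \in G -> h \in G -> [~ g, h] != 1 ->
  A1_subgroup G <<[set g; h]>>.
Proof.
move=> Gg Gh ngh; have sHG : <<[set g; h]>> \subset G.
  by rewrite gen_subG subUset !sub1set Gg.
split=> //; apply/mingroupP; split; first exact: gen2_nonabelian.
move=> K nabK sKH; case: (maximal_exists sKH) => // -[M maxM sKM].
case/negP: nabK; apply: abelianS sKM _; set H := <<_>>%G in maxM.
have pH : p.-group H := pgroupS sHG pG.
have sMH : M \subset H := proper_sub (maxgroupp maxM).
have sMG := subset_trans sMH sHG.
have sPM := Phi_sub_max maxM.
apply: contraT => nabM.
have : p ^ 2 <= #|M : 'Phi(H)|.
  apply: nonabelian_central_index (pgroupS sMG pG) _ nabM.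
  by rewrite subsetI sPM (subset_trans (Phi_central sHG)) ?centS.
have : #|H : 'Phi(H)| <= p ^ 2.
  by rewrite (leq_trans (Phi_index_le pH)) // leq_exp2l ?prime_gt1 ?grank_set2.
rewrite -(Lagrange_index sMH sPM) (p_maximal_index pH maxM) => le_p2 /(leq_trans le_p2).
by rewrite -{2}[#|M : _|]mul1n leq_pmul2r // leqNgt prime_gt1.
Qed.

Lemma A1_gen2 H : A1_subgroup G H ->
  exists g h, [/\ g \in G, h \in G, [~ g, h] != 1 & H :=: <<[set g; h]>>].
Proof.
case=> sHG /mingroupP[nabH minH].
have [g Hg nCg] := subsetPn nabH.
have /subsetPn[h Hh nCgh] : ~~ (H \subset 'C[g]).
  by rewrite -cent_set1 centsC sub1set.
have ngh : [~ g, h] != 1.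
  by apply: contra nCgh => /commgP cgh; apply/cent1P.
exists g, h; rewrite !(subsetP sHG) //; split=> //.
apply/esym/minH; first exact: gen2_nonabelian.
by rewrite gen_subG subUset !sub1set Hg.
Qed.

(** The subgroup M = Phi(G) H has index at least p^2 over Phi(G), while G has index at most p^3. So
    M is G or maximal, and an element outside a maximal M completes the generation; Phi(G) drops out
    as a set of non-generators. *)
Lemma third_generator (g h : gT) : 'm(G) = 3 -> g \in G -> h \in G ->
  [~ g, h] != 1 -> exists2 k, k \in G & <<[set g; h]>> <*> <[k]> = G.
Proof.
move=> dG Gg Gh ngh; set H := <<[set g; h]>>%G.
have sHG : H \subset G by rewrite gen_subG subUset !sub1set Gg.
pose M := ('Phi(G) <*> H)%G.
have sPM : 'Phi(G) \subset M := joing_subl _ _.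
have sHM : H \subset M := joing_subr _ _.
have sMG : M \subset G by rewrite join_subG Phi_sub.
have cM : p ^ 2 <= #|M : 'Phi(G)|.
  apply: nonabelian_central_index; first exact: pgroupS sMG pG.
    by rewrite subsetI sPM (subset_trans (Phi_central (subxx G))) ?centS.
  by apply: contra (gen2_nonabelian ngh); apply: abelianS.
have PhiK K : M <*> K = G -> H <*> K = G.
  move=> /= defG; rewrite -[RHS](@Phi_nongen _ G (H <*> K)) ?genGid //.
  by rewrite joingA.
case: (maximal_exists sMG) => [defM | [N maxN sMN]].
  by exists 1; rewrite ?group1 //; apply: PhiK; rewrite /= cycle1 joingG1.
have sNG := proper_sub (maxgroupp maxN).
have eMN : M :=: N.
  apply/eqP; rewrite eqEsubset sMN -indexg_eq1 eqn_leq indexg_gt0 andbT /=.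
  have := Phi_index_le pG.
  rewrite dG -(Lagrange_index sNG (subset_trans sPM sMN)).
  rewrite (p_maximal_index pG maxN) expnS leq_pmul2l ?prime_gt0 //.
  rewrite -(Lagrange_index sMN sPM) -[(p ^ 2)%N]mul1n => le2.
  rewrite -(leq_pmul2r (indexg_gt0 M 'Phi(G))) (leq_trans le2) //.
  by rewrite leq_pmul2l.
have [k Gk Nk] := subsetPn (proper_subn (maxgroupp maxN)).
exists k => //; apply: PhiK; rewrite eMN /=.
have sKG : <[k]> \subset G by rewrite cycle_subG.
have defG := mulg_normal_maximal (p_maximal_normal pG maxN) maxN sKG.
apply/eqP; rewrite eqEsubset join_subG sNG sKG /= -{1}defG ?cycle_subG //.
by rewrite mulG_subG joing_subl joing_subr.
Qed.

End MinimalNonabelian.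

(** * Coordinates on G modulo its Frattini subgroup *)

Section Word.

Variables (gT : finGroupType) (p : nat).
Hypothesis p_pr : prime p.

Local Notation V := 'rV['F_p]_3.

Definition word3 (x y z : gT) (v : V) : gT :=
  x ^+ v 0%R 0%R * y ^+ v 0%R 1%R * z ^+ v 0%R (inord 2).

Variables (A : {group gT}) (abelA : p.-abelem A) (x y z : gT).
Hypotheses (Ax : x \in A) (Ay : y \in A) (Az : z \in A).

(** Exponents are representatives of residues; the reduction modulo p in the sum is harmless because
    [t] has order dividing p. *)
Lemma expg_FpD t (a b : 'F_p) : t \in A -> t ^+ (a + b)%R = t ^+ a * t ^+ b.
Proof.
move=> At; have [_ expA] := abelemP p_pr abelA.
rewrite -expgD -(expg_mod (a + b) (expA t At)) /=.
by congr (t ^+ (_ %% _)); apply: Fp_cast.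
Qed.

Lemma word3M : {in [set: V] &, {morph word3 x y z : u v / u * v}}.
Proof.
move=> u v _ _; rewrite /word3 !mxE !expg_FpD //.
have cA : {in A &, commutative mulg}.
  by move=> s t As At; apply: (centsP (abelem_abelian abelA)).
move: (u _ _) (v _ _) (u _ _) (v _ _) (u _ _) (v _ _) => c c' b b' a a'.
have [Aa Ab'] := (groupX a' Ax, groupX b' Ay).
rewrite !mulgA -(mulgA (x ^+ a)) (cA (x ^+ a')) ?groupX // !mulgA.
rewrite -(mulgA _ (y ^+ b')) (cA (y ^+ b')) ?groupX // !mulgA.
by rewrite -(mulgA _ (x ^+ a') (z ^+ c)) (cA (x ^+ a')) ?groupX // !mulgA.
Qed.

Canonical word3_morphism := Morphism word3M.

Lemma word3_e :
  [/\ word3 x y z (vec3 1 0 0)%R = x, word3 x y z (vec3 0 1 0)%R = y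
    & word3 x y z (vec3 0 0 1)%R = z].
Proof.
have F1 : (1 %% (Zp_trunc (pdiv p)).+2 = 1)%N.
  by rewrite Fp_cast ?modn_small ?prime_gt1.
by split; rewrite /word3 !mxE !inordK //= ?F1 !expg0 !expg1 ?mulg1 ?mul1g.
Qed.

End Word.

Section Coordinates.

Variables (gT : finGroupType) (p : nat).
Hypothesis p_pr : prime p.

Local Notation V := 'rV['F_p]_3.

Variables (G : {group gT}) (pG : p.-group G) (PhiZ : 'Phi(G) \subset 'Z(G)).
Hypotheses (p_odd : odd p) (dG : 'm(G) = 3).
Hypotheses (G'elem : p.-abelem G^`(1)) (G'card : #|G^`(1)| = (p ^ 3)%N).
Variables (m : nat) (m_gt0 : 0 < m) (w : 'M['F_p]_3) (a1 a2 a3 : gT).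
Hypotheses (Ga1 : a1 \in G) (Ga2 : a2 \in G) (Ga3 : a3 \in G).

Hypothesis defG' :
  <[coset G^`(1) a1]> \x <[coset G^`(1) a2]> \x <[coset G^`(1) a3]>
    = G / G^`(1).
Hypotheses (oa1 : #[coset G^`(1) a1] = (p ^ m)%N)
  (oa2 : #[coset G^`(1) a2] = (p ^ m)%N) (oa3 : #[coset G^`(1) a3] = (p ^ m)%N).

Local Notation e1 := (vec3 1%R 0%R 0%R : V).
Local Notation e2 := (vec3 0%R 1%R 0%R : V).
Local Notation e3 := (vec3 0%R 0%R 1%R : V).

(** An abstract parametrization of G' by row vectors, to be instantiated by [word3] on the three
    basic commutators. *)
Variable phi : V -> gT.
Hypotheses (phiD : {morph phi : u v / (u + v)%R >-> u * v})
  (phi_der : forall v, phi v \in G^`(1)).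
Hypotheses (phi1 : phi e1 = [~ a2, a3]) (phi2 : phi e2 = [~ a3, a1])
  (phi3 : phi e3 = [~ a1, a2]).
Hypotheses (a1p : a1 ^+ (p ^ m) = phi (e1 *m w)%R)
  (a2p : a2 ^+ (p ^ m) = phi (e2 *m w)%R) (a3p : a3 ^+ (p ^ m) = phi (e3 *m w)%R).

Lemma comm_der g h : g \in G -> h \in G -> [~ g, h] \in G^`(1).
Proof. exact: mem_commg. Qed.

Lemma der_central : G^`(1) \subset 'C(G).
Proof.
rewrite (subset_trans _ (Phi_central pG PhiZ (subxx G))) //.
by rewrite (Phi_joing pG) joing_subl.
Qed.

Lemma phi0 : phi 0%R = 1.
Proof. by apply: (mulIg (phi 0%R)); rewrite -phiD add0r mul1g. Qed.

Lemma phiN v : phi (- v)%R = (phi v)^-1.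
Proof. by apply/eqP; rewrite eq_sym eq_invg_mul -phiD subrr phi0. Qed.

Lemma commMl g h k : g \in G -> h \in G -> k \in G ->
  [~ g * h, k] = [~ g, k] * [~ h, k].
Proof.
move=> Gg Gh Gk; rewrite commMgJ /conjg (centsP der_central _ (comm_der Gg Gk)) //.
by rewrite mulKg.
Qed.

Lemma commMr g h k : g \in G -> h \in G -> k \in G ->
  [~ g, h * k] = [~ g, h] * [~ g, k].
Proof.
move=> Gg Gh Gk; rewrite commgMJ /conjg (centsP der_central _ (comm_der Gg Gh)) //.
by rewrite mulKg (centsP der_central _ (comm_der Gg Gk)) // groupR.
Qed.

Lemma der_expp c : c \in G^`(1) -> c ^+ p = 1.
Proof. by have [_ expA] := abelemP p_pr G'elem; apply: expA. Qed.

Lemma der_exppm c : c \in G^`(1) -> c ^+ (p ^ m) = 1.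
Proof. by move=> /der_expp cp; rewrite -(prednK m_gt0) expnS expgM cp expg1n. Qed.

(** In class two the correction term is a commutator raised to the binomial coefficient of p^m over
    2, and p^m divides this coefficient because p is odd. *)
Lemma exppmM g h : g \in G -> h \in G ->
  (g * h) ^+ (p ^ m) = g ^+ (p ^ m) * h ^+ (p ^ m).
Proof.
move=> Gg Gh; have cz := centsP der_central _ (comm_der Gh Gg).
rewrite expMg_Rmul; try by apply/commute_sym/cz.
rewrite bin2odd ?oddX ?p_odd ?orbT // expgM.
by rewrite (der_exppm (comm_der Gh Gg)) expg1n mulg1.
Qed.

(* coord g u says that u is the coordinate vector of the class of g in
   G / Phi(G), but only through the p ^ m-th power and the commutators of g;
   this makes it multiplicative without computing modulo Phi(G). *)
Definition half_coord g u :=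
  [/\ g \in G, g ^+ (p ^ m) = phi (u *m w)%R, [~ g, a1] = phi (cross u e1),
      [~ g, a2] = phi (cross u e2) & [~ g, a3] = phi (cross u e3)].

Definition coord g u :=
  half_coord g u /\
  forall h v, half_coord h v -> [~ h, g] = phi (cross v u).

Lemma coordM g h u v : coord g u -> coord h v -> coord (g * h) (u + v)%R.
Proof.
case=> -[Gg gp g1 g2 g3] gc [[Gh hp h1 h2 h3] hc]; split=> [|k t kt].
  split; first exact: groupM.
  - by rewrite exppmM // gp hp mulmxDl phiD.
  - by rewrite (commMl Gg Gh Ga1) g1 h1 crossDl phiD.
  - by rewrite (commMl Gg Gh Ga2) g2 h2 crossDl phiD.
  - by rewrite (commMl Gg Gh Ga3) g3 h3 crossDl phiD.
have [Gk _ _ _ _] := kt.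
by rewrite (commMr Gk Gg Gh) (gc _ _ kt) (hc _ _ kt) crossDr phiD.
Qed.

Lemma coord_der c : c \in G^`(1) -> coord c 0%R.
Proof.
move=> G'c; have cc := centsP der_central _ G'c.
have cross0l v : cross 0%R v = 0%R :> V.
  by rewrite /cross !mxE !mul0r subrr vec3_0.
have cross0r v : cross v 0%R = 0%R :> V.
  by rewrite /cross !mxE !mulr0 subrr vec3_0.
split=> [|h v [Gh _ _ _ _]]; last first.
  by rewrite cross0r phi0; apply/eqP/commgP/commute_sym/cc.
split; rewrite ?mul0mx ?cross0l ?phi0 ?der_exppm ?(subsetP (der_sub 1 G)) //;
  exact/eqP/commgP/cc.
Qed.

Lemma coordX g u n : coord g u -> coord (g ^+ n) (u *+ n)%R.
Proof.
move=> gu; elim: n => [|n IHn]; first by rewrite mulr0n; apply: coord_der; rewrite group1.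
by rewrite expgS mulrS; apply: coordM.
Qed.

(** For a generator the second clause of [coord] is one of the fields of [half_coord], which is why
    those fields record the commutators with the generators; [coordM] then carries it to
    products. *)
Lemma coord_gens : [/\ coord a1 e1, coord a2 e2 & coord a3 e3].
Proof.
have vN a b c : vec3 (- a)%R (- b)%R (- c)%R = (- vec3 a b c)%R :> V.
  by rewrite -scaleN1r vec3Z !mulN1r.
have eN : [/\ vec3 (-1)%R 0%R 0%R = (- e1)%R :> V,
    vec3 0%R (-1)%R 0%R = (- e2)%R :> V & vec3 0%R 0%R (-1)%R = (- e3)%R :> V].
  by split; rewrite -vN oppr0.
case: eN => eN1 eN2 eN3.
split; split; try (by move=> h v []); split=> //; rewrite cross_vec3;
  rewrite ?(mulr0, mul0r, mulr1, subr0, sub0r, oppr0, addr0);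
  rewrite ?(vec3_0, phi0, commgg) // ?(eN1, eN2, eN3) ?phiN;
  by rewrite ?(phi1, phi2, phi3) ?invg_comm.
Qed.

Lemma mem_der_norm g : g \in G -> g \in 'N(G^`(1)).
Proof. exact/subsetP/der_norm. Qed.

(** Modulo G' every element is a product of powers of the generators, and elements of G' have
    coordinate 0. *)
Lemma coord_exists g : g \in G -> exists u, coord g u.
Proof.
move=> Gg; have [ca1 ca2 ca3] := coord_gens.
have : coset G^`(1) g \in G / G^`(1) by apply: mem_quotient.
rewrite -(dprodW defG'); case/mulsgP=> b _ Hb /cycleP[k ->] gE; move: b Hb gE.
have [[H _ defH _] _ _ _] := dprodP defG'; rewrite defH -(dprodW defH).
move=> _ /mulsgP[_ _ /cycleP[i ->] /cycleP[j ->] ->].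
rewrite -!morphX ?mem_der_norm // -!morphM ?groupX ?groupM ?groupX ?mem_der_norm //.
move/kercoset_rcoset => [||c G'c ->]; rewrite ?groupM ?groupX ?mem_der_norm //.
exists (0 + (e1 *+ i + e2 *+ j + e3 *+ k))%R; apply: coordM (coord_der G'c) _.
exact: coordM (coordM (coordX i ca1) (coordX j ca2)) (coordX k ca3).
Qed.

Lemma coord_surj u : exists g, coord g u.
Proof.
have [ca1 ca2 ca3] := coord_gens; have [[[a b] c] ->] := vec3P u.
exists (a1 ^+ a * a2 ^+ b * a3 ^+ c).
have -> : vec3 a b c = (e1 *+ a + e2 *+ b + e3 *+ c)%R.
  have F n : n = (1 *+ n)%R :> 'F_p by rewrite natr_Zp.
  rewrite {1}[a]F {1}[b]F {1}[c]F; apply/rowP => -[[|[|[|//]]] ?];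
    by rewrite !mxE !mulmxnE !mxE /= ?mul0rn ?addr0 ?add0r.
by apply: coordM; [apply: coordM|]; apply: coordX.
Qed.

Lemma coord_comm g h u v : coord g u -> coord h v -> [~ g, h] = phi (cross u v).
Proof. by case=> gu _ [_]; apply. Qed.

Lemma phiM : {in [set: V] &, {morph phi : u v / u * v}}.
Proof. by move=> u v _ _; rewrite -phiD. Qed.

Canonical phi_morphism := Morphism phiM.

Lemma im_phi : phi @* [set: V] = G^`(1).
Proof.
apply/eqP; rewrite eqEsubset; apply/andP; split.
  by apply/subsetP=> _ /morphimP[v _ _ ->]; apply: phi_der.
rewrite gen_subG; apply/subsetP=> _ /imset2P[g h Gg Gh ->].
have [u gu] := coord_exists Gg; have [v hv] := coord_exists Gh.
by rewrite (coord_comm gu hv) mem_morphim ?inE.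
Qed.

(** [phi] is onto G', whose order p^3 is that of its domain. *)
Lemma phi_injm : 'injm phi.
Proof.
by rewrite -card_im_injm im_phi G'card cardsT card_mx card_Fp ?mul1n.
Qed.

Lemma coord_order g u (N : {group gT}) : coord g u -> g \in 'N(N) ->
  phi (u *m w)%R \in N -> #[coset N g] <= p ^ m.
Proof.
case=> -[_ gp _ _ _] _ nNg Ngp; apply: dvdn_leq; first by rewrite expn_gt0 prime_gt0.
by rewrite order_dvdn -morphX //= gp coset_id.
Qed.

Lemma card_homocyclic : #|G| = (p ^ (m * 3) * p ^ 3)%N.
Proof.
rewrite -(Lagrange (der_sub 1 G)) G'card mulnC -card_quotient ?der_norm //.
have [[H _ defH _] _ _ _] := dprodP defG'.
rewrite -(dprod_card defG') defH -(dprod_card defH) -!orderE oa1 oa2 oa3.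
by rewrite -!expnD !mulnS muln0 addn0 !addnA.
Qed.

(** * Order and index of a two-generated subgroup *)

Section TwoGenerated.

Variables (g h : gT) (u v : V).
Hypotheses (gu : coord g u) (hv : coord h v) (nz : cross u v != 0%R).

Local Notation H := <<[set g; h]>>.
Local Notation N := (phi @* rowg (span_mx w u v)).

Lemma comm_neq1 : [~ g, h] != 1.
Proof.
rewrite (coord_comm gu hv); apply: contra nz => /eqP phi1'.
by apply/eqP/(injmP phi_injm); rewrite /= ?inE ?phi0 // -phi1'.
Qed.

Lemma card_span : #|N| = (p ^ \rank (span_mx w u v))%N.
Proof.
by rewrite card_injm ?phi_injm ?subsetT //; rewrite card_rowg card_Fp.
Qed.

Lemma coord_in k t : coord k t -> k \in G. Proof. by case=> -[]. Qed.

Lemma gen2_sub : H \subset G.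
Proof. by rewrite gen_subG subUset !sub1set (coord_in gu) (coord_in hv). Qed.

Lemma span_sub_der : N \subset G^`(1).
Proof. by rewrite -im_phi morphimS ?subsetT. Qed.

Lemma mem_span t : (t <= span_mx w u v)%MS -> phi t \in N.
Proof. by move=> st; rewrite mem_morphim ?inE. Qed.

Lemma span_sub_gen2 : N \subset H.
Proof.
have Hg : g \in H by rewrite mem_gen // !inE eqxx.
have Hh : h \in H by rewrite mem_gen // !inE eqxx orbT.
apply/subsetP=> _ /morphimP[t _ + ->]; rewrite inE => /submxP[c ->].
have [[_ gp _ _ _] _] := gu; have [[_ hp _ _ _] _] := hv.
rewrite span_mxE -[c]hsubmxK mul_row_col -[rsubmx c]hsubmxK mul_row_col.
have phiZ k (t' : V) : phi t' \in H -> phi (k *: t')%R \in H.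
  move=> Ht; rewrite -[k]natr_Zp scaler_nat; elim: (k : nat) => [|n IHn].
    by rewrite mulr0n phi0.
  by rewrite mulrS phiD groupM.
rewrite [lsubmx c]mx11_scalar [lsubmx (rsubmx c)]mx11_scalar.
rewrite [rsubmx (rsubmx c)]mx11_scalar !mul_scalar_mx.
rewrite /= !phiD !groupM ?phiZ // -?(coord_comm gu hv) -?gp -?hp ?groupR ?groupX //.
Qed.

Lemma span_central : N \subset 'C(G).
Proof. exact: subset_trans span_sub_der der_central. Qed.

Lemma norm_span : G \subset 'N(N).
Proof. by rewrite cents_norm // centsC span_central. Qed.

(** N contains [g, h] and both p^m-th powers, so modulo N the two generators commute and have order
    at most p^m. *)
Lemma card_quo_span_le : #|H / N| <= p ^ (m * 2).
Proof.
have [Ng Nh] := (subsetP norm_span g (coord_in gu), subsetP norm_span h (coord_in hv)).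
rewrite gen_set2 quotientY ?cycle_subG // !quotient_cycle //.
rewrite (leq_trans (card_cent_joing _)) //.
  rewrite cycle_subG /= cent_cycle; apply/cent1P/commute_sym/commgP.
  by rewrite -morphR //= coset_id // (coord_comm gu hv) mem_span // -addsmxE addsmxSl.
rewrite muln2 -addnn expnD leq_mul //.
  apply: coord_order gu Ng _; rewrite mem_span // span_mxE -addsmxE.
  by rewrite (submx_trans _ (addsmxSr _ _)) // -addsmxE addsmxSl.
apply: coord_order hv Nh _; rewrite mem_span // span_mxE -addsmxE.
by rewrite (submx_trans _ (addsmxSr _ _)) // -addsmxE addsmxSr.
Qed.

(** With a third generator [k], the group G / G' of order p^(3m) is the product of H / G' and a
    cyclic group of order at most p^m. *)
Lemma card_quo_der_ge : p ^ (m * 2) <= #|H / G^`(1)|.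
Proof.
have [k Gk genk] := third_generator p_pr pG PhiZ dG (coord_in gu) (coord_in hv) comm_neq1.
have [t kt] := coord_exists Gk.
have nG'H : H \subset 'N(G^`(1)) := subset_trans gen2_sub (der_norm 1 G).
have abG : abelian (G / G^`(1)) := der_abelian 0 G.
have := card_homocyclic; rewrite -(Lagrange (der_sub 1 G)) G'card mulnC.
rewrite -card_quotient ?der_norm // => /eqP.
rewrite eqn_pmul2r ?expn_gt0 ?prime_gt0 // => /eqP cG.
have : #|G / G^`(1)| <= #|H / G^`(1)| * p ^ m.
  have -> : G / G^`(1) = H / G^`(1) <*> <[coset G^`(1) k]>.
    rewrite -quotient_cycle ?mem_der_norm // -quotientY ?cycle_subG //.
      by rewrite genk.
    exact: mem_der_norm.
  apply: leq_trans (card_cent_joing _) _.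
    rewrite /= -quotient_cycle ?mem_der_norm //.
    by rewrite (sub_abelian_cent2 abG) ?quotientS ?gen2_sub ?cycle_subG.
  by rewrite leq_mul2l (coord_order kt) ?orbT ?mem_der_norm ?phi_der.
by rewrite cG (mulnS m 2) expnD mulnC leq_pmul2r // expn_gt0 prime_gt0.
Qed.

(** The order is squeezed between two bounds: N lies in H with |H / N| at most p^(2m), and N lies in
    the intersection of H and G' with |H / G'| at least p^(2m). *)
Lemma card_gen2 : #|H| = (p ^ (m * 2) * p ^ \rank (span_mx w u v))%N.
Proof.
have nNH : H \subset 'N(N) := subset_trans gen2_sub norm_span.
have nGH : H \subset 'N(G^`(1)) := subset_trans gen2_sub (der_norm 1 G).
apply/eqP; rewrite eqn_leq -card_span; apply/andP; split.
  by rewrite -(Lagrange span_sub_gen2) -card_quotient // mulnC leq_mul2r card_quo_span_le orbT.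
rewrite -(LagrangeI H G^`(1)) mulnC -card_quotient //.
by rewrite leq_mul ?card_quo_der_ge // subset_leq_card // subsetI span_sub_gen2 span_sub_der.
Qed.

Lemma index_gen2 : #|G : H| = (p ^ (m + 3 - \rank (span_mx w u v)))%N.
Proof.
have rk3 : \rank (span_mx w u v) <= 3 by apply: rank_leq_row.
rewrite -(divgS gen2_sub) card_homocyclic card_gen2 -!expnD -expnB ?prime_gt0 //.
  by rewrite (mulnS m 2) (addnC m) -addnA subnDl.
by rewrite leq_add // leq_mul.
Qed.

End TwoGenerated.

(** * Translation of I_min and I_max into ranks *)

Lemma A1_spectrum K : A1_subgroup G K ->
  exists2 s, rank_spectrum w s & #|G : K| = (p ^ (m + 3 - s))%N.
Proof.
move=> /A1_gen2[g [h [Gg Gh ngh ->]]].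
have [u gu] := coord_exists Gg; have [v hv] := coord_exists Gh.
have nz : cross u v != 0%R.
  by apply: contra ngh; rewrite (coord_comm gu hv) => /eqP->; rewrite phi0.
by exists (\rank (span_mx w u v)); [exists u, v | apply: index_gen2].
Qed.

Lemma spectrum_A1 s : rank_spectrum w s ->
  exists2 K : {group gT}, A1_subgroup G K & #|G : K| = (p ^ (m + 3 - s))%N.
Proof.
case=> u [v [nz <-]]; have [g gu] := coord_surj u; have [h hv] := coord_surj v.
exists <<[set g; h]>>%G; last exact: index_gen2.
exact: (gen2_A1 p_pr pG PhiZ (coord_in gu) (coord_in hv) (comm_neq1 gu hv nz)).
Qed.

Lemma spectrum_eq s j : rank_spectrum w s -> j <= 3 ->
  (p ^ (m + 3 - s) = p ^ (m + j))%N -> rank_spectrum w (3 - j).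
Proof.
move=> ws j3 /eqP; rewrite eqn_exp2l ?prime_gt1 //.
have /andP[_] := spectrum_le ws; rewrite leq_min => /andP[s3 _].
(* The bound s <= 3 keeps the truncated subtraction exact. *)
by rewrite -addnBA // eqn_add2l => /eqP <-; rewrite subKn.
Qed.

Lemma Imin_spectrum j : j <= 3 -> is_Imin p G (m + j) ->
  rank_spectrum w (3 - j) /\ forall s, rank_spectrum w s -> s <= 3 - j.
Proof.
move=> j3 [[K /A1_spectrum[s ws ->] eq_s] min_j].
split=> [|{s ws eq_s} s ws]; first exact: spectrum_eq eq_s.
have /andP[_] := spectrum_le ws; rewrite leq_min => /andP[s3 _].
have [K' /min_j + eqK'] := spectrum_A1 ws.
by rewrite eqK' leq_exp2l ?prime_gt1 // -addnBA // leq_add2l !leq_subRL // addnC.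
Qed.

Lemma Imax_spectrum j : j <= 3 -> is_Imax p G (m + j) ->
  rank_spectrum w (3 - j) /\ forall s, rank_spectrum w s -> 3 - j <= s.
Proof.
move=> j3 [[K /A1_spectrum[s ws ->] eq_s] max_j].
split=> [|{s ws eq_s} s ws]; first exact: spectrum_eq eq_s.
have /andP[_] := spectrum_le ws; rewrite leq_min => /andP[s3 _].
have [K' /max_j + eqK'] := spectrum_A1 ws.
by rewrite eqK' leq_exp2l ?prime_gt1 // -addnBA // leq_add2l !leq_subLR addnC.
Qed.

End Coordinates.

(** * The matrices of the list *)

Section List.

Local Open Scope ring_scope.

Variable p : nat.
Hypothesis p_pr : prime p.

Ltac mat3_entries :=
  by apply/matrixP => -[[|[|[|//]]] ?] -[[|[|[|//]]] ?];
     rewrite !mxE -?val_eqE /= ?mxE ?inordK //= ?mulr0 ?mulr1 ?oppr0 ?addr0 ?add0r.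

Lemma J1E : J1 p = mat3 1 0 0 0 1 0 0 0 1. Proof. mat3_entries. Qed.
Lemma J2E : J2 p = mat3 1 0 0 0 0 1 0 (-1) 0. Proof. mat3_entries. Qed.
Lemma J3E nu : J3 nu = mat3 1 0 0 0 nu 1 0 (-1) 0 :> 'M['F_p]_3.
Proof. mat3_entries. Qed.
Lemma J4E r : J4 r = mat3 1 0 0 0 1 1 0 (-1) r :> 'M['F_p]_3.
Proof. mat3_entries. Qed.
Lemma J5E : J5 p = mat3 0 0 1 0 1 1 1 (-1) 0. Proof. mat3_entries. Qed.
Lemma K1E nu : K1 nu = mat3 1 0 0 0 nu 0 0 0 0 :> 'M['F_p]_3.
Proof. mat3_entries. Qed.
Lemma K2E : K2 p = mat3 1 0 0 0 0 1 0 0 0. Proof. mat3_entries. Qed.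
Lemma K3E : K3 p = mat3 0 0 1 0 0 0 0 1 0. Proof. mat3_entries. Qed.
Lemma K4E : K4 p = mat3 0 0 0 0 0 1 0 (-1) 0. Proof. mat3_entries. Qed.
Lemma K5E : K5 p = mat3 0 0 0 0 1 1 0 (-1) 0. Proof. mat3_entries. Qed.
Lemma K6E r : K6 r = mat3 0 0 0 0 1 1 0 (-1) r :> 'M['F_p]_3.
Proof. mat3_entries. Qed.
Lemma L1E : L1 p = mat3 0 0 0 0 0 0 0 0 0. Proof. mat3_entries. Qed.
Lemma L2E : L2 p = mat3 1 0 0 0 0 0 0 0 0. Proof. mat3_entries. Qed.
Lemma L3E : L3 p = mat3 0 0 0 0 0 1 0 0 0. Proof. mat3_entries. Qed.

(** Stopping at p - 2 leaves both r and r + 1 strictly between 0 and p. *)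
Lemma r_rangeP (r : 'F_p) : r \in r_range p -> r != 0 /\ r + 1 != 0.
Proof.
case/mapP=> k; rewrite mem_iota => /andP[k1 kp] ->.
have {kp} kp : (k.+1 < p)%N.
  by move: kp; rewrite addnBA ?prime_gt1 // ltn_subRL.
rewrite natr1 -!(dvdn_pcharf (pchar_Fp p_pr)); split.
  by rewrite gtnNdvd // ltnW.
by rewrite gtnNdvd.
Qed.

Variable eta : 'F_p.
Hypothesis eta_neq0 : eta != 0.

Lemma nu_rangeP (nu : 'F_p) : nu \in nu_range eta -> nu != 0.
Proof. by rewrite !inE => /orP[] /eqP->; rewrite ?oner_neq0. Qed.

Lemma neq0_eq (F : fieldType) (a b : F) : a != 0 -> b = a -> b != 0.
Proof. by move=> ? ->. Qed.

Let n1 := oner_neq0 'F_p.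

(** The determinants are 1 for (J1)-(J3), r + 1 for (J4) and -1 for (J5). *)
Lemma J_unit w : w \in J_list eta -> w \in unitmx.
Proof.
rewrite /J_list !mem_cat unitmxE unitfE.
case/or4P => [ | /mapP[nu _ ->] | /mapP[r /r_rangeP[_ r1] ->] | ].
- rewrite !inE => /orP[]/eqP->.
  + by rewrite J1E det_mat3; apply: neq0_eq n1 _; ring.
  by rewrite J2E det_mat3; apply: neq0_eq n1 _; ring.
- by rewrite J3E det_mat3; apply: neq0_eq n1 _; ring.
- by rewrite J4E det_mat3; apply: neq0_eq r1 _; ring.
by rewrite mem_seq1 => /eqP->; rewrite J5E det_mat3 -oppr_eq0; apply: neq0_eq n1 _; ring.
Qed.

Lemma J_spectrum3 w : w \in J_list eta -> rank_spectrum w 3.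
Proof.
(* The cross product of e2 and e3 is e1, so the determinant is the lower right 2 x 2 minor of [w],
   equal to 1 or r + 1 throughout the list. *)
move=> Jw; apply: (@det_span_mx _ w (vec3 0 1 0) (vec3 0 0 1)); move: Jw.
rewrite /J_list !mem_cat.
case/or4P => [ | /mapP[nu _ ->] | /mapP[r /r_rangeP[_ r1] ->] | ].
- rewrite !inE => /orP[]/eqP->.
  + by rewrite J1E !spanE; apply: neq0_eq n1 _; ring.
  by rewrite J2E !spanE; apply: neq0_eq n1 _; ring.
- by rewrite J3E !spanE; apply: neq0_eq n1 _; ring.
- by rewrite J4E !spanE; apply: neq0_eq r1 _; ring.
by rewrite mem_seq1 => /eqP->; rewrite J5E !spanE; apply: neq0_eq n1 _; ring.
Qed.

Lemma K_spectrum3 w : w \in K_list eta -> rank_spectrum w 3.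
Proof.
rewrite /K_list !mem_cat.
case/or3P => [/mapP[nu /nu_rangeP nu0 ->] | | /mapP[r /r_rangeP[_ r1] ->]].
- by rewrite K1E; apply: spectrum3_K1.
- rewrite !inE => /or4P[]/eqP->.
  + by rewrite K2E; apply: spectrum3_K2.
  (* The cross product of e3 and e1 is e2, which equals e3 w; the kernel vector e2 is subtracted
     from e1 to avoid this coincidence. *)
  + rewrite K3E; apply: (@det_span_mx _ _ (vec3 0 0 1) (vec3 1 (-1) 0)).
    by rewrite !spanE; apply: neq0_eq n1 _; ring.
  + rewrite K4E; apply: (@det_span_mx _ _ (vec3 0 1 0) (vec3 0 0 1)).
    by rewrite !spanE; apply: neq0_eq n1 _; ring.
  rewrite K5E; apply: (@det_span_mx _ _ (vec3 0 1 0) (vec3 0 0 1)).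
  by rewrite !spanE; apply: neq0_eq n1 _; ring.
by rewrite K6E; apply: spectrum3_K6.
Qed.

Lemma e_rank i j : \rank (e p i j) = 1%N.
Proof. exact: mxrank_delta. Qed.

(** These matrices have rank at most one, and the cross product adds at most one more. *)
Lemma L_spectrum3 w : w \in L_list p -> ~ rank_spectrum w 3.
Proof.
rewrite !inE => Lw /spectrum_le; rewrite leq_min ltnS => /and3P[_ _].
by case/or3P: Lw => /eqP->; rewrite ?e_rank // mxrank0.
Qed.

Lemma L1_spectrum2 : ~ rank_spectrum (L1 p) 2.
Proof. by move/spectrum_le; rewrite mxrank0. Qed.

Let cross0E := (@mulr1 'F_p, @mul1r 'F_p, @mulr0 'F_p, @mul0r 'F_p,
  @subr0 'F_p, @sub0r 'F_p, @oppr0 'F_p).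

Lemma sq_spectrum1_K1 (nu a : 'F_p) : - nu = a ^+ 2 ->
  rank_spectrum (K1 nu) 1.
Proof.
move=> sq; have -> : nu = - a ^+ 2 by rewrite -sq opprK.
(* The plane contains the kernel vector e3; its normal (-1, a, 0) is proportional to the image (a,
   -a^2, 0) of the second vector. *)
rewrite K1E; apply: (@spectrum1_intro _ _ (vec3 0 0 1) (vec3 a 1 0) 0 (- a));
  rewrite cross_vec3 ?mul_vec3_mat3 ?vec3Z.
- by rewrite vec3_eq0 !cross0E ?oppr_eq0 ?eqxx ?oner_eq0 ?andbF.
- by congr vec3; ring.
- by congr vec3; ring.
Qed.

Lemma sq_spectrum1_K6 (r a : 'F_p) : - r = a ^+ 2 ->
  rank_spectrum (K6 r) 1.
Proof.
move=> sq; have -> : r = - a ^+ 2 by rewrite -sq opprK.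
(* The plane contains the kernel vector e1; its normal is (0, -1, a), and the second vector maps to
   (0, a - 1, a - a^2). *)
rewrite K6E; apply: (@spectrum1_intro _ _ (vec3 1 0 0) (vec3 0 a 1) 0 (1 - a));
  rewrite cross_vec3 ?mul_vec3_mat3 ?vec3Z.
- by rewrite vec3_eq0 !cross0E ?oppr_eq0 ?eqxx ?oner_eq0 ?andbF.
- by congr vec3; ring.
- by congr vec3; ring.
Qed.

(** In each case the first witness spans the kernel and the second is mapped to a multiple of the
    normal. *)
Lemma spectrum1_K345 w : w \in [:: K3 p; K4 p; K5 p] -> rank_spectrum w 1.
Proof.
rewrite !inE => /or3P[]/eqP->.
- rewrite K3E; apply: (@spectrum1_intro _ _ (vec3 0 1 0) (vec3 1 0 0) 0 (-1));
    rewrite cross_vec3 ?mul_vec3_mat3 ?vec3Z; try by congr vec3; ring.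
  by rewrite vec3_eq0 !cross0E ?oppr_eq0 ?eqxx ?oner_eq0 ?andbF.
- rewrite K4E; apply: (@spectrum1_intro _ _ (vec3 1 0 0) (vec3 0 1 0) 0 1);
    rewrite cross_vec3 ?mul_vec3_mat3 ?vec3Z; try by congr vec3; ring.
  by rewrite vec3_eq0 !cross0E ?oppr_eq0 ?eqxx ?oner_eq0 ?andbF.
rewrite K5E; apply: (@spectrum1_intro _ _ (vec3 1 0 0) (vec3 0 0 1) 0 1);
  rewrite cross_vec3 ?mul_vec3_mat3 ?vec3Z; try by congr vec3; ring.
by rewrite vec3_eq0 !cross0E ?oppr_eq0 ?eqxx ?oner_eq0 ?andbF.
Qed.

(** The witnesses span a plane inside the kernel. *)
Lemma spectrum1_L w : w \in L_list p -> rank_spectrum w 1.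
Proof.
rewrite !inE => /or3P[]/eqP->.
- rewrite L1E; apply: (@spectrum1_intro _ _ (vec3 1 0 0) (vec3 0 1 0) 0 0);
    rewrite cross_vec3 ?mul_vec3_mat3 ?vec3Z; try by congr vec3; ring.
  by rewrite vec3_eq0 !cross0E ?oppr_eq0 ?eqxx ?oner_eq0 ?andbF.
- rewrite L2E; apply: (@spectrum1_intro _ _ (vec3 0 1 0) (vec3 0 0 1) 0 0);
    rewrite cross_vec3 ?mul_vec3_mat3 ?vec3Z; try by congr vec3; ring.
  by rewrite vec3_eq0 !cross0E ?oppr_eq0 ?eqxx ?oner_eq0 ?andbF.
rewrite L3E; apply: (@spectrum1_intro _ _ (vec3 1 0 0) (vec3 0 0 1) 0 0);
  rewrite cross_vec3 ?mul_vec3_mat3 ?vec3Z; try by congr vec3; ring.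
by rewrite vec3_eq0 !cross0E ?oppr_eq0 ?eqxx ?oner_eq0 ?andbF.
Qed.

(** This separates (L2) and (L3) from (L1): some vector of a plane has its image off the normal
    line. *)
Lemma spectrum_ge2_L23 w : w \in [:: L2 p; L3 p] ->
  exists2 s, rank_spectrum w s & (1 < s)%N.
Proof.
have ge2 w' (u v : 'rV['F_p]_3) : cross u v != 0 ->
    (forall k, u *m w' <> k *: cross u v) ->
    exists2 s, rank_spectrum w' s & (1 < s)%N.
  move=> nz nuw; exists (\rank (span_mx w' u v)); first by exists u, v.
  rewrite ltn_neqAle eq_sym rank_span_mx_gt0 // andbT.
  by apply/(rank_span_mx1P w' nz) => -[k [l [/nuw]]].
rewrite !inE => /orP[]/eqP->.
- rewrite L2E; apply: (ge2 _ (vec3 1 0 0) (vec3 0 1 0)).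
    by rewrite cross_vec3 vec3_eq0 !cross0E ?oppr_eq0 ?eqxx ?oner_eq0 ?andbF.
  move=> k; rewrite cross_vec3 mul_vec3_mat3 vec3Z => /vec3_inj[/eqP].
  by rewrite !(cross0E, addr0, add0r) oner_eq0.
rewrite L3E; apply: (ge2 _ (vec3 0 1 0) (vec3 0 0 1)).
  by rewrite cross_vec3 vec3_eq0 !cross0E ?oppr_eq0 ?eqxx ?oner_eq0 ?andbF.
move=> k; rewrite cross_vec3 mul_vec3_mat3 vec3Z => /vec3_inj[_ _ /eqP].
by rewrite !(cross0E, addr0, add0r) oner_eq0.
Qed.

Lemma spectrum1_K1_sq (nu : 'F_p) : nu != 0 -> rank_spectrum (K1 nu) 1 ->
  - nu \in Fp_squares p.
Proof.
by move=> nu0; rewrite K1E => /(spectrum1_K1 nu0)[a a0 ->]; apply/imsetP; exists a; rewrite ?inE.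
Qed.

Lemma spectrum1_K6_sq (r : 'F_p) : r != 0 -> r + 1 != 0 ->
  rank_spectrum (K6 r) 1 -> - r \in Fp_squares p.
Proof.
by move=> r0 r1; rewrite K6E => /(spectrum1_K6 r0 r1)[a a0 ->]; apply/imsetP; exists a; rewrite ?inE.
Qed.

Lemma K2_spectrum1 : ~ rank_spectrum (K2 p) 1.
Proof. by rewrite K2E; apply: spectrum1_K2. Qed.

End List.

(** * The five conclusions, by cases over the list *)

Theorem theorem6p3 (p : nat) (p_pr : prime p) (p_odd : odd p)
    (eta : 'F_p) (eta_neq0 : eta != 0%R) (eta_nsq : eta \notin Fp_squares p)
    (gT : finGroupType) (G : {group gT}) (pG : p.-group G)
    (dG : 'm(G) = 3%N) (PhiZ : 'Phi(G) \subset 'Z(G))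
    (G'elem : p.-abelem G^`(1)) (G'card : #|G^`(1)| = (p ^ 3)%N)
    (m1 m2 m3 : nat) (m12 : m2 <= m1) (m23 : m3 <= m2) (m3_ge1 : 1 <= m3)
    (G_ab : abelian_type (G / G^`(1)) = [:: (p ^ m1)%N; (p ^ m2)%N; (p ^ m3)%N])
    (eq_m12 : m1 = m2) (eq_m23 : m2 = m3)
    (w : 'M['F_p]_3) (wG : characteristic_matrix G m1 m2 m3 w)
    (w_list : w \in J_list eta ++ K_list eta ++ L_list p) :
  (is_Imin p G m3 -> w \in J_list eta ++ K_list eta) /\
  (is_Imin p G (m3 + 1) -> w \in [:: L2 p; L3 p]) /\
  (is_Imin p G (m3 + 2) -> w = L1 p) /\
  (is_Imax p G (m1 + 2) ->
     w \in [seq K1 nu | nu <- nu_range eta & (- nu)%R \in Fp_squares p]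
       ++ [:: K3 p; K4 p; K5 p]
       ++ [seq K6 r | r <- r_range p & (- r)%R \in Fp_squares p]
       ++ L_list p) /\
  (is_Imax p G (m1 + 1) ->
     w \in J_list eta
       ++ [seq K1 nu | nu <- nu_range eta & (- nu)%R \notin Fp_squares p]
       ++ [:: K2 p]
       ++ [seq K6 r | r <- r_range p & (- r)%R \notin Fp_squares p]).
Proof.
subst m2 m1; move=> {m12 m23}.
case: wG => a1 [a2 [a3 [[Ga1 Ga2 Ga3] defQ [o1 o2 o3] [w1 w2 w3]]]].
have [Gx Gy Gz] : [/\ [~ a2, a3] \in G^`(1), [~ a3, a1] \in G^`(1)
    & [~ a1, a2] \in G^`(1)] by rewrite !mem_commg.
pose phi := word3 [~ a2, a3] [~ a3, a1] [~ a1, a2] : 'rV['F_p]_3 -> gT.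
have phiD : {morph phi : u v / (u + v)%R >-> u * v}.
  by move=> u v; apply: (word3M p_pr G'elem); rewrite ?inE.
have phi_der v : phi v \in G^`(1) by rewrite !groupM ?groupX.
have [phi1 phi2 phi3] := word3_e p_pr [~ a2, a3] [~ a3, a1] [~ a1, a2].
have i1 : idx3 1 = 0%R by apply: val_inj; rewrite /= inordK.
have i2 : idx3 2 = 1%R by apply: val_inj; rewrite /= inordK.
(* The product of the i-th unit row with [w] is row i of [w], so the power relations become
   statements about [phi]. *)
have powE i (v : 'rV['F_p]_3) : v = delta_mx 0%R (idx3 i) ->
    [~ a2, a3] ^+ w (idx3 i) (idx3 1) * [~ a3, a1] ^+ w (idx3 i) (idx3 2)
      * [~ a1, a2] ^+ w (idx3 i) (idx3 3) = phi (v *m w)%R.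
  by move=> ->; rewrite -rowE /phi /word3 !mxE i1 i2.
have vE i : (0 < i <= 3)%N ->
    vec3 (i == 1%N)%:R%R (i == 2)%:R%R (i == 3)%:R%R = delta_mx 0%R (idx3 i) :> 'rV['F_p]_3.
  case: i => [|[|[|[|//]]]] // _; apply/rowP => -[[|[|[|//]]] ?];
    by rewrite !mxE /= -?val_eqE /= ?inordK.
rewrite (powE 1%N _ (vE 1%N isT)) in w1; rewrite (powE 2 _ (vE 2 isT)) in w2.
rewrite (powE 3 _ (vE 3 isT)) in w3.
have min := Imin_spectrum p_pr pG PhiZ p_odd dG G'elem G'card m3_ge1 Ga1 Ga2 Ga3
  defQ o1 o2 o3 phiD phi_der phi1 phi2 phi3 w1 w2 w3.
have max := Imax_spectrum p_pr pG PhiZ p_odd dG G'elem G'card m3_ge1 Ga1 Ga2 Ga3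
  defQ o1 o2 o3 phiD phi_der phi1 phi2 phi3 w1 w2 w3.
have JK3 : w \in J_list eta ++ K_list eta -> rank_spectrum w 3.
  by rewrite mem_cat => /orP[/(J_spectrum3 p_pr)|/(K_spectrum3 p_pr eta_neq0)].
have {w_list} : (w \in J_list eta ++ K_list eta) || (w \in L_list p).
  by rewrite -mem_cat -catA.
move=> w_list; split.
  rewrite -[X in is_Imin p G X]addn0 => /(min 0 isT)[s3 _].
  by case/orP: w_list => // /L_spectrum3/(_ s3).
split.
  case/(min 1%N isT) => s2 le2; case/orP: w_list => [/JK3/le2 // | ].
  rewrite !inE => /or3P[/eqP wL | -> | ->]; rewrite ?orbT //.
  by move: s2; rewrite wL => /L1_spectrum2.
split.
  (* All ranks are now at most 1, which excludes (J) and (K) by rank three, and (L2), (L3) by a rank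
     above one. *)
  case/(min 2 isT) => _ le1; case/orP: w_list => [/JK3/le1 // | ].
  rewrite [_ \in _]in_cons => /orP[/eqP-> // | /spectrum_ge2_L23[s /le1 s1]].
  by rewrite ltnNge s1.
have {}w_list : [|| w \in J_list eta, w \in [seq K1 nu | nu <- nu_range eta],
    w \in [:: K2 p; K3 p; K4 p; K5 p], w \in [seq K6 r | r <- r_range p]
    | w \in L_list p].
  by move: w_list; rewrite !mem_cat -!orbA.
(* I_max = m + 2 says that rank 1 is attained, I_max = m + 1 that every rank is at least 2; both
   cases reduce to deciding which matrices attain rank 1. *)
split=> [/(max 2 isT)[s1 _] | /(max 1%N isT)[_ ge2]].
  rewrite !mem_cat; case/orP: w_list => [/(J_unit p_pr)/spectrum1_unit/(_ s1) // | /or4P[]].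
  - case/mapP=> nu nu_in wE; rewrite wE in s1 *.
    by rewrite map_f // mem_filter nu_in spectrum1_K1_sq // (nu_rangeP eta_neq0).
  - rewrite in_cons => /orP[/eqP wE | ->]; last by rewrite orbT.
    by move: s1; rewrite wE => /K2_spectrum1.
  - case/mapP=> r r_in wE; rewrite wE in s1 *; have [r0 r1] := r_rangeP p_pr r_in.
    by rewrite map_f ?orbT // mem_filter r_in spectrum1_K6_sq.
  by move=> ->; rewrite !orbT.
have nsp1 : ~ rank_spectrum w 1 by move/ge2.
rewrite mem_cat; case/orP: w_list => [-> // | K_or_L].
apply/orP; right; rewrite !mem_cat; case/or4P: K_or_L.
- case/mapP=> nu nu_in wE; rewrite wE in nsp1 *.
  rewrite map_f // mem_filter nu_in andbT.
  by apply/negP => /imsetP[a _ /sq_spectrum1_K1].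
- rewrite in_cons => /orP[/eqP-> | /spectrum1_K345/nsp1 //].
  by rewrite mem_head !orbT.
- case/mapP=> r r_in wE; rewrite wE in nsp1 *.
  rewrite [X in _ || (_ || X)]map_f ?orbT // mem_filter r_in andbT.
  by apply/negP => /imsetP[a _ /sq_spectrum1_K6].
by move/spectrum1_L/nsp1.
Qed.
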